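(* Let $M$ be the weighted adjacency matrix of a finite simple loopless graph $G$ on $n$ vertices with edge weights in $\mathbb{Z}[w,r]$, let $C_k(M)$ be the total weight of the unoriented simple $k$-cycles of $G$, and let $k\ge3$. Then $$C_k(M)=\frac{1}{2k}\sum_{\substack{T\subseteq[n]\\|T|=k}}\ \sum_{S\subseteq T}(-1)^{k-|S|}\operatorname{tr}\bigl(M[S]^k\bigr)=\frac{1}{2k}\sum_{\substack{S\subseteq[n]\\|S|\le k}}(-1)^{k-|S|}\binom{n-|S|}{k-|S|}\operatorname{tr}\bigl(M[S]^k\bigr),$$ with the convention $\binom ab=0$ for $b<0$ or $b>a$. Consequently, for an oriented non-split alternating link $L$ and $k\ge3$, $$CWR_k(L)=\bigl(C_k(\overline A_B),\,C_k(\overline A_W)\bigr),$$ where $\overline A_B$, $\overline A_W$ are the weighted adjacency matrices of the consolidated Tait graphs $G_B^*$, $G_W^*$ of $L$, and where, for $M=\overline A_B$ and for $M=\overline A_W$ (with $n$ the size of the matrix $M$ in question), $$C_k(M)=\frac{1}{2k}\sum_{\substack{S\subseteq[n]\\|S|\le k}}(-1)^{k-|S|}\binom{n-|S|}{k-|S|}\operatorname{tr}\bigl(M[S]^k\bigr).$$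
   Context: The weighted adjacency matrix $M=(m_{ij})$ of $G$ (vertices $v_1,\ldots,v_n$) is the symmetric matrix with $m_{ij}=\operatorname{wg}(e)$ if $v_i,v_j$ are joined by an edge $e$, and $m_{ij}=0$ otherwise. The weight of a cycle $C$ is $\prod_{e\in E(C)}\operatorname{wg}(e)$, and $C_k(M)$ is the sum of the weights of all unoriented simple cycles of length $k$ in $G$. Write $[n]=\{1,\ldots,n\}$. For $S\subseteq[n]$, $M[S]=(m_{ij})_{i,j\in S}$ is the principal submatrix indexed by $S$; for $S=\varnothing$, $\operatorname{tr}(M[S]^k)=0$ for $k\ge1$. Tait graphs and $CWR$. Let $D$ be a reduced (no nugatory crossings) alternating diagram of an oriented non-split alternating link $L$. The regions of $D$ are checkerboard coloured black and white, so that regions sharing an edge have opposite colours; which class is called black is fixed once and for all by a local rule depending on the over/under pattern at crossings, the same rule for all diagrams (the statement holds for either choice of rule). The Tait graph $G_B$ has one vertex for each black region and one edge for each crossing, joining the black regions meeting at that crossing; $G_W$ is defined in the same way from white regions. Each edge $e$ gets weight $\operatorname{wg}(e)=w$ if the crossing is positive and $r$ if it is negative, where $w,r$ are commuting indeterminates. The consolidated Tait graph $G_B^*$ is the weighted simple graph obtained from $G_B$ by replacing all parallel edges joining the same pair of vertices by a single edge whose weight is the product of their weights; $G_W^*$ is obtained from $G_W$ likewise. For $i>2$, $CB_i(w,r)=\sum_C\prod_{e\in E(C)}\operatorname{wg}(e)$, summed over all unoriented simple cycles $C$ of length $i$ in $G_B^*$; $CW_i$ is defined analogously from $G_W^*$;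 and $CWR_i=(CB_i,CW_i)$. It is a known theorem that $CWR_i$ does not depend on the chosen reduced alternating diagram $D$ of $L$; $CWR_i(L)$ denotes the common value. *)

(* Defs.v *)
From HB Require Import structures.
From Stdlib Require Import Relation_Operators ClassicalEpsilon.
From mathcomp Require Import all_boot all_order all_fingroup all_algebra.
From mathcomp Require Import mpoly.
Set Implicit Arguments.
Unset Strict Implicit.
Unset Printing Implicit Defensive.
Import GRing.Theory.
Local Open Scope ring_scope.

(** * Coefficients *)

Notation Zwr := {mpoly int[2]}.
Notation Qwr := {mpoly rat[2]}.

Definition ind_w : Zwr := mpolyX int (mnm1 (@ord0 1)).
Definition ind_r : Zwr := mpolyX int (mnm1 (@ord_max 1)).

(* Z[w,r] inside Q[w,r], where 1/(2k) makes sense. *)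
Definition toQwr (p : Zwr) : Qwr := map_mpoly (intr : int -> rat) p.

(** * Weighted graphs *)

(* Vertices are the members of [gverts], a subset of the finite type [T]. *)
Record wgraph (T : finType) := WGraph {
  gverts : {set T};
  gedges : {set {set T}};
  gwt : {set T} -> Zwr;
  gedgesP : forall e, e \in gedges -> #|e| = 2%N /\ e \subset gverts }.

Record wmultigraph (T : finType) := WMultigraph {
  mverts : {set T};
  medge : finType;
  mends : medge -> {set T};
  mwt : medge -> Zwr;
  mendsP : forall x, mends x \subset mverts }.

(* An edge with one end only is a loop; it is dropped. *)
Definition consolidated_edges (T : finType) (H : wmultigraph T) : {set {set T}} :=
  [set e in [set mends x | x : medge H] | #|e| == 2%N].

Lemma consolidated_edgesP (T : finType) (H : wmultigraph T) e :
  e \in consolidated_edges H -> #|e| = 2%N /\ e \subset mverts H.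
Proof.
rewrite inE => /andP[/imsetP[x _ ->] /eqP c2]; split=> //.
exact: mendsP.
Qed.

Definition consolidate (T : finType) (H : wmultigraph T) : wgraph T :=
  {| gverts := mverts H;
     gedges := consolidated_edges H;
     gwt := fun e => \prod_(x : medge H | mends x == e) mwt x;
     gedgesP := @consolidated_edgesP T H |}.

(* [v] lists the vertices of [G] as v_1, ..., v_n without repetition. *)
Definition labels (T : finType) (G : wgraph T) (n : nat) (v : 'I_n -> T) : Prop :=
  injective v /\ (forall x, x \in gverts G <-> exists i, v i = x).

Definition wadj (T : finType) (G : wgraph T) (n : nat) (v : 'I_n -> T) : 'M[Zwr]_n :=
  \matrix_(i, j) if [set v i; v j] \in gedges G then gwt G [set v i; v j] else 0.

(* For k >= 3 an unoriented simple k-cycle is determined by its edge set. *)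
Definition circuit_edges (T : finType) (t : seq T) : {set {set T}} :=
  [set [set x; next t x] | x in t].

Definition is_cycle (T : finType) (k : nat) (G : wgraph T) (C : {set {set T}}) : bool :=
  [exists t : k.-tuple T,
    [&& uniq t, C == circuit_edges t & C \subset gedges G]].

Definition cycle_sum (k : nat) (T : finType) (G : wgraph T) : Zwr :=
  \sum_(C : {set {set T}} | is_cycle k G C) \prod_(e in C) gwt G e.

Definition principal (n : nat) (M : 'M[Zwr]_n) (S : {set 'I_n}) : 'M[Zwr]_#|S| :=
  \matrix_(i, j) M (enum_val i) (enum_val j).

Definition trace_sum_pairs (k n : nat) (M : 'M[Zwr]_n) : Zwr :=
  \sum_(T : {set 'I_n} | #|T| == k) \sum_(S : {set 'I_n} | S \subset T)
    (-1) ^+ (k - #|S|) * \tr (principal M S ^+ k).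

Definition trace_sum (k n : nat) (M : 'M[Zwr]_n) : Zwr :=
  \sum_(S : {set 'I_n} | (#|S| <= k)%N)
    (-1) ^+ (k - #|S|) * \tr (principal M S ^+ k) *+ 'C(n - #|S|, k - #|S|).

(** * Oriented link diagrams on the sphere *)

(* A diagram is given by its signed Gauss code.  Walking along each component
   in the direction of its orientation, one records the passages [(x, b)]
   through the crossings [x], with [b = true] for the overpass; each component
   is thus a cyclic word, empty for a circle without crossings.  A planar
   connected code determines the diagram on the sphere up to orientation
   preserving homeomorphism; for a disconnected one it determines the connected
   pieces, hence still the link (their split union). *)
Record gauss_code := GaussCode {
  ncross : nat;
  comps : seq (seq ('I_ncross * bool));
  positive : 'I_ncross -> bool }.

Definition passage (D : gauss_code) : finType := ('I_(ncross D) * bool)%type.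

(* Half-edges at the crossings: [(p, true)] leaves the crossing along the
   strand of the passage [p], [(p, false)] arrives along it. *)
Definition dart (D : gauss_code) : finType := (passage D * bool)%type.

Definition crossing (D : gauss_code) (d : dart D) : 'I_(ncross D) := d.1.1.
Definition over (D : gauss_code) (d : dart D) : bool := d.1.2.

Definition comp_of (D : gauss_code) (p : passage D) : seq (passage D) :=
  nth [::] (comps D) (find (fun c : seq (passage D) => p \in c) (comps D)).
Definition succ_passage (D : gauss_code) (p : passage D) : passage D := next (comp_of p) p.
Definition pred_passage (D : gauss_code) (p : passage D) : passage D := prev (comp_of p) p.

Definition other_end (D : gauss_code) (d : dart D) : dart D :=
  if d.2 then (succ_passage d.1, false) else (pred_passage d.1, true).

(* Clockwise around a positive crossing the half-edges are: under-in, over-in,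
   under-out, over-out; around a negative one: under-in, over-out, under-out,
   over-in. *)
Definition clockwise (D : gauss_code) (d : dart D) : dart D :=
  ((crossing d, ~~ over d), d.2 (+) (over d == positive (crossing d))).

(* The corner of [d] is the sector between [d] and the next half-edge
   counterclockwise.  [next_corner] walks around the region on the left of [d],
   so that a region is encoded by the set of its corners. *)
Definition next_corner (D : gauss_code) (d : dart D) : dart D :=
  clockwise (other_end d).
Definition region_of (D : gauss_code) (d : dart D) : {set dart D} :=
  [set d' | fconnect (@next_corner D) d d'].

Definition adjacent (D : gauss_code) : rel 'I_(ncross D) := fun x y =>
  [exists b : bool, ((succ_passage (x, b) : passage D).1 == y)
                    || ((succ_passage (y, b) : passage D).1 == x)].

(* Number of connected components of the part of the projection that carries
   crossings, and of the whole projection. *)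
Definition ncrossed_pieces (D : gauss_code) : nat :=
  n_comp (@adjacent D) predT.
Definition npieces (D : gauss_code) : nat :=
  (ncrossed_pieces D + count (@nilp _) (comps D))%N.

Definition well_formed (D : gauss_code) : Prop :=
  comps D <> [::] /\ perm_eq (flatten (comps D)) (enum {: passage D}).

(* Euler's formula V - E + F = 2 c, with E = 2 V. *)
Definition planar (D : gauss_code) : Prop :=
  #|[set region_of d | d : dart D]| = (ncross D + 2 * ncrossed_pieces D)%N.

Record diagram := Diagram {
  code :> gauss_code;
  codeP : well_formed code /\ planar code }.

(** * Reidemeister moves and links *)

Definition rotation_of (T : eqType) (u v : seq T) : bool :=
  [exists i : 'I_(size v).+1, u == rot i v].

Definition same_cyclic_words (T : eqType) (us vs : seq (seq T)) : Prop :=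
  exists2 us', perm_eq us us' & all2 (@rotation_of T) us' vs.

(* [D'] has cyclic words [ws] and the crossings of [D] outside [R], with their
   signs, up to the naming of the crossings and the listing of the words. *)
Definition presented_by (D' D : gauss_code) (R : {set 'I_(ncross D)})
    (ws : seq (seq (passage D))) : Prop :=
  exists f : 'I_(ncross D') -> 'I_(ncross D),
    [/\ injective f,
        f @: setT = ~: R,
        forall x, positive x = positive (f x)
      & same_cyclic_words [seq [seq (f p.1, p.2) | p <- c] | c <- comps D'] ws].

Definition isomorphic (D D' : gauss_code) : Prop :=
  presented_by D' set0 (comps D).

Definition erases (D D' : gauss_code) (R : {set 'I_(ncross D)}) : Prop :=
  presented_by D' R
    [seq [seq p : passage D <- c | p.1 \notin R] | c <- comps D].

(* Remove a monogon. *)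
Definition reidemeister1 (D D' : gauss_code) : Prop :=
  exists2 d : dart D, next_corner d = d & erases D' [set crossing d].

(* Remove a bigon one of whose sides, that of [d], is over at both ends. *)
Definition reidemeister2 (D D' : gauss_code) : Prop :=
  exists d : dart D, let d' := next_corner d in
    [/\ next_corner d' = d,
        crossing d != crossing d',
        over d && over (other_end d)
      & erases D' [set crossing d; crossing d']].

Definition swap_side (D : gauss_code) (d : dart D) : {perm (passage D)} :=
  tperm d.1 (other_end d).1.

(* Across a triangle one of whose sides is over at both ends: the two passages
   on each side of the triangle are exchanged. *)
Definition reidemeister3 (D D' : gauss_code) : Prop :=
  exists d : dart D, let d' := next_corner d in let d'' := next_corner d' in
    [/\ next_corner d'' = d,
        uniq [:: crossing d; crossing d'; crossing d''],
        over d && over (other_end d)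
      & presented_by D' set0
          [seq [seq (swap_side d * swap_side d' * swap_side d'')%g p | p <- c]
             | c <- comps D]].

Definition elementary_move (D D' : diagram) : Prop :=
  [\/ isomorphic D D', reidemeister1 D D', reidemeister2 D D'
    | reidemeister3 D D'].

Definition isotopic : diagram -> diagram -> Prop :=
  clos_refl_sym_trans diagram elementary_move.

(* An oriented link type, as the class of all its diagrams. *)
Record oriented_link := OrientedLink {
  diagram_of : diagram -> Prop;
  diagram_ofP : exists D0, forall D, diagram_of D <-> isotopic D0 D }.

Definition non_split (L : oriented_link) : Prop :=
  forall D, diagram_of L D -> npieces D = 1%N.

Definition alternating (D : gauss_code) : Prop :=
  forall p : passage D, (succ_passage p).2 = ~~ p.2.

Definition alternating_link (L : oriented_link) : Prop :=
  exists2 D, diagram_of L D & alternating D.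

(* Some region occupies two opposite corners at [x]. *)
Definition nugatory (D : gauss_code) (x : 'I_(ncross D)) : Prop :=
  exists b, region_of (((x, b), false) : dart D) = region_of (((x, b), true) : dart D).

Definition reduced (D : gauss_code) : Prop :=
  forall x : 'I_(ncross D), ~ nugatory x.

Definition reduced_alternating_diagram (L : oriented_link) (D : diagram) : Prop :=
  [/\ diagram_of L D, reduced D & alternating D].

(** * Tait graphs *)

(* The corners swept when an overstrand is rotated counterclockwise up to the
   understrand are those of over half-edges.  In an alternating diagram
   [next_corner] preserves [over], so [over] is the checkerboard colouring.
   The only connected diagram without crossings is the circle, whose two
   regions, one of each colour, have no corners. *)
Definition regions (D : gauss_code) (b : bool) : {set {set dart D}} :=
  if ncross D == 0%N then [set set0]
  else [set region_of d | d : dart D & over d == b].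

Definition tait_ends (D : gauss_code) (b : bool) (x : 'I_(ncross D)) :
    {set {set dart D}} :=
  [set region_of (((x, b), false) : dart D); region_of (((x, b), true) : dart D)].

Lemma tait_endsP (D : gauss_code) (b : bool) (x : 'I_(ncross D)) :
  tait_ends b x \subset regions D b.
Proof.
have n0 : (ncross D == 0%N) = false by case: (ncross D) x => // -[].
rewrite /regions n0; apply/subsetP => R.
by rewrite !inE => /orP[] /eqP ->; apply: imset_f; rewrite inE /over /= eqxx.
Qed.

Definition tait_graph (D : gauss_code) (b : bool) : wmultigraph {set dart D} :=
  {| mverts := regions D b;
     medge := 'I_(ncross D);
     mends := @tait_ends D b;
     mwt := fun x => if positive x then ind_w else ind_r;
     mendsP := @tait_endsP D b |}.

(* [rule] says which corners are called black: those of over half-edges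
   ([true]) or those of under half-edges ([false]). *)
Definition black_star (rule : bool) (D : gauss_code) : wgraph {set dart D} :=
  consolidate (tait_graph D rule).
Definition white_star (rule : bool) (D : gauss_code) : wgraph {set dart D} :=
  consolidate (tait_graph D (~~ rule)).

Definition CWR_diagram (rule : bool) (i : nat) (D : gauss_code) : Zwr * Zwr :=
  (cycle_sum i (black_star rule D), cycle_sum i (white_star rule D)).

Definition CWR_well_defined (rule : bool) (i : nat) (L : oriented_link) : Prop :=
  forall D D', reduced_alternating_diagram L D -> reduced_alternating_diagram L D' ->
    CWR_diagram rule i D = CWR_diagram rule i D'.

(* The value on some reduced alternating diagram of [L], hence the common value
   on all of them when there is one. *)
Definition CWR (rule : bool) (i : nat) (L : oriented_link) : Zwr * Zwr :=
  epsilon (inhabits (0, 0)) (fun p =>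
    exists2 D, reduced_alternating_diagram L D & p = CWR_diagram rule i D).

(* Main.v *)
(** Expanding the trace, [tr (M[S]^k)] is the weighted sum of the closed walks of
    length [k] with all their vertices in [S].  By inclusion-exclusion over
    [S \subset T] only the walks visiting all of [T] survive; as [#|T| = k],
    these are the injective ones.  An injective closed walk runs once around a
    cycle, or has weight 0, and each cycle is run around by [2k] such walks:
    its [k] starting points and two directions.  In terms of indices in [Z/k],
    two walks with the same edge set differ by [i |-> a + i] or [i |-> a - i],
    since an injective [s] with [s (i + 1) = s i +- 1] never turns back. *)
Require Import Defs.
From mathcomp Require Import all_boot all_order all_fingroup all_algebra.
From mathcomp Require Import mpoly ring.
Set Implicit Arguments.
Unset Strict Implicit.
Unset Printing Implicit Defensive.
Import GRing.Theory.
Local Open Scope ring_scope.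

(** * Traces of powers as sums over closed walks *)

Section ClosedWalks.
Variables (R : comNzRingType) (n : nat) (M : 'M[R]_n).
Implicit Types (S T : {set 'I_n}).

Fixpoint walk_weight (x : 'I_n) (s : seq 'I_n) : R :=
  if s is y :: s' then M x y * walk_weight y s' else 1.

Lemma walk_weightE x0 x s m : size s = m ->
  walk_weight x s = \prod_(l < m) M (nth x0 (x :: s) l) (nth x0 s l).
Proof.
move=> <-; elim: s x => [|y s IH] x /=; first by rewrite big_ord0.
by rewrite big_ord_recl IH.
Qed.

Definition closed_walk_weight k (f : {ffun 'I_k -> 'I_n}) : R :=
  \prod_i M (f i) (f (ordS i)).

Lemma sum_tuple_cons k (P : pred 'I_n) (F : seq 'I_n -> R) :
  \sum_(t : k.+1.-tuple 'I_n | all P t) F t =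
  \sum_(x | P x) \sum_(t : k.-tuple 'I_n | all P t) F (x :: t).
Proof.
rewrite pair_big_dep /=.
rewrite (reindex (fun p : 'I_n * k.-tuple 'I_n => [tuple of p.1 :: p.2])) //=.
exists (fun t : k.+1.-tuple 'I_n => (thead t, [tuple of behead t])).
  by move=> [x t] _ /=; congr pair; apply: val_inj.
by move=> t _; rewrite [RHS]tuple_eta.
Qed.

(** The tuple holds the [k] inner vertices of a walk of [k.+1] steps; induction peels off the first
    step. *)
Lemma principal_exp_entry S k (i j : 'I_#|S|) :
  (mxsub enum_val enum_val M ^+ k.+1) i j =
  \sum_(t : k.-tuple 'I_n | all (mem S) t)
    walk_weight (enum_val i) (rcons t (enum_val j)).
Proof.
elim: k i => [|k IH] i.
  rewrite expr1 mxE (big_pred1 [tuple]) /= ?mulr1 // => t.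
  by rewrite tuple0 /= eqxx.
rewrite exprS mxE.
rewrite (sum_tuple_cons _ (mem S)
  (fun s => walk_weight (enum_val i) (rcons s (enum_val j)))) [RHS]big_enum_val /=.
apply: eq_bigr => y _; rewrite IH mxE big_distrr /=.
by apply: eq_bigr.
Qed.

Lemma trace_principal_exp S k :
  \tr (mxsub (@enum_val _ (mem S)) enum_val M ^+ k.+1) =
  \sum_(f : {ffun 'I_k.+1 -> 'I_n} | [forall i, f i \in S])
    closed_walk_weight f.
Proof.
have -> : \tr (mxsub (@enum_val _ (mem S)) enum_val M ^+ k.+1) =
    \sum_(t : k.+1.-tuple 'I_n | all (mem S) t)
      closed_walk_weight [ffun i => tnth t i].
  transitivity (\sum_(t : k.+1.-tuple 'I_n | all (mem S) t)
      (if val t is x :: t' then walk_weight x (rcons t' x) else 0)).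
    rewrite (sum_tuple_cons _ (mem S)
      (fun s => if s is x :: t then walk_weight x (rcons t x) else 0)).
    rewrite [RHS]big_enum_val /mxtrace; apply: eq_bigr => i _.
    exact: principal_exp_entry.
  apply: eq_bigr => t _; case/tupleP: t => x t /=.
  rewrite (@walk_weightE x _ _ k.+1) ?size_rcons ?size_tuple //.
  apply: eq_bigr => i _; rewrite !ffunE !(tnth_nth x) /=.
  congr (M _ _).
    rewrite -rcons_cons nth_rcons /= size_tuple ltn_ord.
    by [].
  rewrite nth_rcons size_tuple.
  (* At the last index the walk reads the appended [x], matching [ordS], which wraps round to 0. *)
  have := ltn_ord i; rewrite ltnS leq_eqVlt => /orP[/eqP e|lt].
    by rewrite e ltnn eqxx modnn.
  by rewrite lt modn_small.
rewrite (reindex (fun f : {ffun 'I_k.+1 -> 'I_n} => [tuple f i | i < k.+1])) /=.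
  apply: eq_big => [f|f _].
    apply/allP/forallP => [H i|H _ /mapP[i _ ->]]; last exact: H.
    by apply/H/map_f; rewrite mem_enum.
  by congr closed_walk_weight; apply/ffunP => i; rewrite ffunE tnth_mktuple.
exists (fun t => [ffun i => tnth t i]) => [f|t] _.
  by apply/ffunP => i; rewrite ffunE tnth_mktuple.
by apply: eq_from_tnth => i; rewrite tnth_mktuple ffunE.
Qed.

End ClosedWalks.

(** * Inclusion-exclusion over vertex sets *)

Lemma sum_sign_interval (R : comNzRingType) (I : finType) (A T : {set I}) :
  A \subset T ->
  \sum_(S : {set I} | (S \subset T) && (A \subset S)) (-1) ^+ (#|T| - #|S|)
    = (A == T)%:R :> R.
Proof.
move=> AT.
pose F i : R := (i \in T)%:R.
pose G i : R := if i \in A then 0 else (-1) ^+ (i \in T).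
(* Expanded over the sets J of indices i at which F i is chosen, this product
   gives the signed sum over J. *)
transitivity (\prod_i (F i + G i)).
  rewrite bigA_distr big_mkcond /=; apply: eq_bigr => S _.
  case: ifP => [/andP[ST AS]|].
    rewrite -cardsDS // -sum1_card -prodrXr big_mkcond /=.
    apply: eq_bigr => i _; rewrite inE /F /G.
    case: (boolP (i \in S)) => [iS|iS] /=; first by rewrite (subsetP ST).
    have /negbTE -> : i \notin A by apply: contra iS; exact: (subsetP AS).
    by case: (i \in T).
  (* Outside the interval some factor vanishes: [F] off [T], or [G] on [A]. *)
  move=> /negbT; rewrite negb_and => /orP[/subsetPn[i iS iT]|/subsetPn[i iA iS]].
    by rewrite (bigD1 i) //= iS /F (negbTE iT) mul0r.
  by rewrite (bigD1 i) //= (negbTE iS) /G iA mul0r.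
(* The factor at [i] is 0 for [i] in [T] but not in [A], and 1 otherwise. *)
case: eqVneq => [eAT|neq].
  rewrite big1 // => i _; rewrite /F /G -eAT.
  by case: (i \in A); rewrite ?addr0 ?add0r.
have /subsetPn[i iT iA] : ~~ (T \subset A).
  by apply: contra neq => TA; rewrite eqEsubset AT.
by rewrite (bigD1 i) //= /F /G (negbTE iA) iT subrr mul0r.
Qed.

(** Taking the union with [S] matches the subsets of [~: S] of size [k - #|S|] with these
    supersets. *)
Lemma card_supersets (I : finType) (S : {set I}) k : (#|S| <= k)%N ->
  #|[set T : {set I} | (#|T| == k) && (S \subset T)]| = 'C(#|I| - #|S|, k - #|S|).
Proof.
move=> leSk.
have <- : #|~: S| = (#|I| - #|S|)%N by rewrite -(cardsC S) addKn.
rewrite -cards_draws -[RHS](card_in_imset (f := fun U => S :|: U)).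
  apply: eq_card => T; rewrite inE; apply/andP/imsetP => [[/eqP cT ST]|[U]].
    exists (T :\: S); last by rewrite setDE setUIr setUCr setIT (setUidPr ST).
    by rewrite inE setDE subsetIr -setDE cardsDS // cT eqxx.
  rewrite inE => /andP[SU /eqP cU] ->; rewrite subsetUl; split=> //.
  by rewrite cardsU disjoint_setI0 ?cards0 ?subn0 ?cU ?subnKC //
    disjoint_sym disjoints_subset.
move=> U V; rewrite !inE => /andP[SU _] /andP[SV _].
move=> /(congr1 (fun X : {set I} => X :\: S)).
rewrite !setDUl setDv !set0U !setDE.
by rewrite (setIidPl SU) (setIidPl SV).
Qed.

Lemma trace_sum_pairsE k n (M : 'M[Zwr]_n) : trace_sum_pairs k M = trace_sum k M.
Proof.
rewrite /trace_sum_pairs (exchange_big_dep xpredT) //= [RHS]big_mkcond /=.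
apply: eq_bigr => S _; case: leqP => leSk.
  rewrite sumr_const; congr (_ *+ _).
  by have := card_supersets leSk; rewrite card_ord cardsE.
rewrite big_pred0 // => T; apply/negbTE/negP => /andP[/eqP cT] /subset_leq_card.
by rewrite cT leqNgt leSk.
Qed.

(** For a fixed walk [f], the signs over the [S] between its image and [T] cancel unless [T] is the
    image. That image is among the [T] of size [k.+1] exactly when [f] is injective. *)
Lemma trace_sum_pairs_injective k n (M : 'M[Zwr]_n) :
  trace_sum_pairs k.+1 M =
  \sum_(f : {ffun 'I_k.+1 -> 'I_n} | injectiveb f) closed_walk_weight M f.
Proof.
have imE (f : {ffun 'I_k.+1 -> 'I_n}) (S : {set 'I_n}) :
    [forall i, f i \in S] = (f @: setT \subset S).
  apply/forallP/subsetP => [fS _ /imsetP[i _ ->] //|fS i].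
  exact/fS/imset_f.
transitivity (\sum_(T : {set 'I_n} | #|T| == k.+1)
    \sum_(f : {ffun 'I_k.+1 -> 'I_n} | f @: setT \subset T)
      closed_walk_weight M f * (f @: setT == T)%:R).
  apply: eq_bigr => T /eqP cT.
  transitivity (\sum_(S : {set 'I_n} | S \subset T)
      \sum_(f : {ffun 'I_k.+1 -> 'I_n} | f @: setT \subset S)
         closed_walk_weight M f * (-1) ^+ (#|T| - #|S|)).
    apply: eq_bigr => S _; rewrite cT mulrC trace_principal_exp mulr_suml.
    by apply: eq_bigl => f.
  rewrite (exchange_big_dep (fun f : {ffun 'I_k.+1 -> 'I_n} => f @: setT \subset T)) /=.
    apply: eq_bigr => f fT; rewrite -mulr_sumr -(sum_sign_interval _ fT).
    by [].
  by move=> S f ST /subset_trans; apply.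
rewrite (exchange_big_dep xpredT) //= [RHS]big_mkcond; apply: eq_bigr => f _ /=.
have -> : injectiveb f = (#|f @: setT| == k.+1).
  transitivity (#|f @: setT| == #|[set: 'I_k.+1]|); last by rewrite cardsT card_ord.
  apply/injectiveP/imset_injP => [fi x y _ _|fi x y]; first exact: fi.
  by apply: fi; rewrite inE.
case: ifP => [cf|ncf].
  rewrite (bigD1 (f @: setT)) /= ?cf ?subxx // eqxx mulr1 big1 ?addr0 // => T.
  by move=> /andP[_]; rewrite eq_sym => /negbTE ->; rewrite mulr0.
rewrite big1 // => T /andP[cT _]; case: eqVneq => [e|]; last by rewrite mulr0.
by rewrite e cT in ncf.
Qed.

(** * Cyclic edge sets and their dihedral symmetries *)

Definition cyc_edges k (T : finType) (f : 'I_k -> T) : {set {set T}} :=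
  [set [set f i; f (ordS i)] | i : 'I_k].

(** Lengths are written [k.+3] so that indices form the ring of integers modulo k + 3, in which 2 is
    nonzero. *)
Lemma ordS_add1 k (i : 'I_k.+3) : ordS i = i + 1.
Proof. apply: val_inj.
by rewrite /= modnDmr addn1.
Qed.

Lemma set2_eqP (T : finType) (a b c d : T) :
  [set a; b] = [set c; d] -> (a = c /\ b = d) \/ (a = d /\ b = c).
Proof.
move=> E; have a_in : a \in [set c; d] by rewrite -E set21.
have b_in : b \in [set c; d] by rewrite -E set22.
have c_in : c \in [set a; b] by rewrite E set21.
have d_in : d \in [set a; b] by rewrite E set22.
case/set2P: a_in => ?; subst a.
  case/set2P: d_in => ?; subst d; last by left.
  by case/set2P: b_in; left.
case/set2P: c_in => ?; subst c; last by right.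
by case/set2P: b_in; right.
Qed.

Section Dihedral.
Variable k : nat.
Implicit Types i j : 'I_k.+3.

Lemma ord_neq_opp1 : (1 : 'I_k.+3) != - 1.
Proof. by rewrite -subr_eq0 opprK. Qed.

Definition dihedral (p : 'I_k.+3 * bool) (i : 'I_k.+3) : 'I_k.+3 :=
  p.1 + (-1) ^+ p.2 * i.

Lemma dihedral_inj p : injective (dihedral p).
Proof. by move=> i j /addrI; case: p.2; rewrite ?expr1 ?mulN1r ?mul1r // => /oppr_inj. Qed.

(** The first step fixes a direction [b], and injectivity forbids every later reversal. *)
Lemma dihedral_steps (s : 'I_k.+3 -> 'I_k.+3) : injective s ->
  (forall i, s (i + 1) = s i + 1 \/ s i = s (i + 1) + 1) ->
  exists p, s =1 dihedral p.
Proof.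
move=> si step.
have [b Hb] : exists b : bool, s 1 = s 0 + (-1) ^+ b.
  have := step 0; rewrite add0r => -[->|->]; first by exists false.
  by exists true; rewrite addrK.
exists (s 0, b) => i; rewrite /dihedral /=.
suff H m : s m%:R = s 0 + (-1) ^+ b * m%:R /\ s m.+1%:R = s 0 + (-1) ^+ b * m.+1%:R.
  by rewrite -(natr_Zp i); case: (H i).
elim: m => [|m [IH1 IH2]]; first by rewrite mulr0 addr0 mulr1.
(* A reversal would give equal values at m and m + 2, hence 2 = 0. Of the four combinations of [b]
   and the next step, [ne] excludes two and the others continue in direction [b]. *)
split=> //; have ne : s m.+2%:R != s m%:R.
  apply/eqP => /si E; have E2 := natrD 'I_k.+3 m 2.
  have /eqP// : 2%:R = 0 :> 'I_k.+3.
  by apply: (addrI m%:R); rewrite addr0 -E2 addn2 E.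
have := step m.+1%:R; rewrite natr1; move: ne; rewrite IH2 IH1.
rewrite -[m.+2%:R]natr1 -[m.+1%:R]natr1; set x := s _; set y := s 0.
case: (b) => /eqP ne [E|E].
- by case: ne; rewrite E; ring.
- by apply: (addIr 1); rewrite -E; ring.
- by rewrite E; ring.
- by case: ne; apply: (addIr 1); rewrite -E; ring.
Qed.

Lemma cyc_edges_dihedral (T : finType) (f : 'I_k.+3 -> T) p :
  cyc_edges (f \o dihedral p) = cyc_edges f.
Proof.
case: p => a b; apply/setP => e; apply/imsetP/imsetP => -[i _ ->] /=.
- rewrite ordS_add1 /dihedral /= mulrDr addrA mulr1; set j := a + _.
  case: b @j => j; last by exists j; rewrite // ordS_add1.
  (* A reversed step goes from [j] to [j - 1], along the edge indexed by [j - 1]. *)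
  by exists (j - 1); rewrite // ordS_add1 subrK setUC.
- case: b.
    (* The reflection sends this index to [i + 1] and its successor to [i]. *)
    exists (a - (i + 1)) => //; rewrite !ordS_add1 /dihedral /= setUC.
    by congr [set f _; f _]; ring.
  exists (i - a) => //; rewrite !ordS_add1 /dihedral /=.
  by congr [set f _; f _]; ring.
Qed.
(** The value at 0 gives the offset; the value at 1 then gives the sign, as 1 and -1 differ. *)
Lemma dihedral_param_inj (p q : 'I_k.+3 * bool) :
  dihedral p =1 dihedral q -> p = q.
Proof.
case: p q => [a b] [c d] E; have := E 0; rewrite /dihedral /= !mulr0 !addr0 => eac.
have := E 1; rewrite /dihedral /= eac !mulr1 => /addrI.
have /eqP ne := ord_neq_opp1.
by case: b {E}; case: d => //=; rewrite ?expr1 // => /esym.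
Qed.

(** Every vertex of [g] is one of [f], so [g] is [f] after a reindexing [s]; each edge of [g] being
    an edge of [f], [s] moves by one at each step. *)
Lemma cyc_edges_eq_dihedral (T : finType) (f g : 'I_k.+3 -> T) :
  injective f -> injective g -> cyc_edges g = cyc_edges f ->
  exists p, g =1 f \o dihedral p.
Proof.
move=> fi gi E.
have edge i : exists j, [set g i; g (i + 1)] = [set f j; f (j + 1)].
  have : [set g i; g (ordS i)] \in cyc_edges f by rewrite -E; apply: imset_f.
  by case/imsetP => j _; rewrite !ordS_add1; exists j.
have g_codom i : exists j, g i == f j.
  have [j /set2_eqP[[-> _]|[-> _]]] := edge i; by eexists.
pose s i := xchoose (g_codom i).
have sE i : g i = f (s i) by apply/eqP/(xchooseP (g_codom i)).
have si : injective s by move=> i j e; apply: gi; rewrite !sE e.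
have [i|p sp] := dihedral_steps si.
  have [j] := edge i; rewrite !sE.
  by case/set2_eqP => -[/fi -> /fi ->]; auto.
by exists p => i; rewrite sE sp.
Qed.

(** The fiber is a free dihedral orbit: [k.+3] offsets times two directions. *)
Lemma card_cyc_edges_fiber (T : finType) (f : {ffun 'I_k.+3 -> T}) : injective f ->
  #|[set g : {ffun 'I_k.+3 -> T} | injectiveb g && (cyc_edges g == cyc_edges f)]|
    = (2 * k.+3)%N.
Proof.
move=> fi.
transitivity #|[set [ffun i => f (dihedral p i)] | p : 'I_k.+3 * bool]|; last first.
  rewrite card_imset ?card_prod ?card_ord ?card_bool 1?mulnC //.
  move=> p q /ffunP E; apply: dihedral_param_inj => i.
  by apply: fi; have := E i; rewrite !ffunE.
apply: eq_card => g; rewrite inE; apply/andP/imsetP => [[/injectiveP gi /eqP]|[p _ ->]].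
  move=> /(cyc_edges_eq_dihedral fi gi)[p gp]; exists p => //.
  by apply/ffunP => i; rewrite ffunE gp.
split.
  by apply/injectiveP => i j; rewrite !ffunE => /fi; apply: dihedral_inj.
rewrite -(cyc_edges_dihedral f p); apply/eqP/eq_imset => i.
by rewrite /= !ffunE.
Qed.

(** Two indices sharing an edge would be successors of each other, giving 2 = 0. Thus a product over
    steps is a product over edges. *)
Lemma cyc_edge_inj (T : finType) (f : 'I_k.+3 -> T) : injective f ->
  injective (fun i => [set f i; f (ordS i)]).
Proof.
move=> fi i j; rewrite !ordS_add1 => /set2_eqP[[/fi]|[/fi -> /fi e]] //.
have /eqP// : 2%:R = 0 :> 'I_k.+3.
by apply: (addrI j); rewrite addr0 -[RHS]e; ring.
Qed.

End Dihedral.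

(** * Cycles of a graph and its injective closed walks *)

Lemma circuit_edges_cyc_edges k (T : finType) (t : k.-tuple T) : uniq t ->
  circuit_edges t = cyc_edges (tnth t).
Proof.
case: k t => [|k] t ut.
  rewrite tuple0 /circuit_edges /cyc_edges.
  by apply/setP => e; apply/imsetP/imsetP => -[] // [].
have nextE i : next t (tnth t i) = tnth t (ordS i).
  have idx : index (tnth t i) t = i.
    by rewrite {1}(tnth_nth (tnth t i)) index_uniq ?size_tuple.
  rewrite next_nth mem_tnth idx; case/tupleP: t {ut idx} => x t.
  rewrite [RHS](tnth_nth x) /=.
  (* For the last vertex, [next_nth] reads past the end of the tail and returns its default, the
     head. *)
  have := ltn_ord i; rewrite ltnS leq_eqVlt => /orP[/eqP e|lt].
    by rewrite e modnn nth_default ?size_tuple.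
  by rewrite modn_small.
apply/setP => e; apply/imsetP/imsetP => [[x /tnthP[i ->] ->]|[i _ ->]].
  by exists i; rewrite ?nextE.
by exists (tnth t i); rewrite ?mem_tnth ?nextE.
Qed.

Lemma is_cycleP k (T : finType) (G : wgraph T) (C : {set {set T}}) :
  reflect (exists f : {ffun 'I_k -> T},
             [/\ injective f, C = cyc_edges f & C \subset gedges G])
          (is_cycle k G C).
Proof.
apply: (iffP existsP) => [[t /and3P[ut /eqP EC CG]]|[f [fi EC CG]]].
  exists [ffun i => tnth t i]; split=> //.
    by move=> i j; rewrite !ffunE => /(tuple_uniqP _ ut).
  rewrite EC circuit_edges_cyc_edges //; apply: eq_imset => i.
  by rewrite !ffunE.
have ut : uniq [tuple f i | i < k].
  by apply/tuple_uniqP => i j; rewrite !tnth_mktuple; apply: fi.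
exists [tuple f i | i < k]; rewrite ut CG andbT.
rewrite circuit_edges_cyc_edges // EC; apply/eqP; apply: eq_imset => i.
by rewrite !tnth_mktuple.
Qed.

(** A step off the graph contributes a zero entry; otherwise each edge is used exactly once. *)
Lemma closed_walk_weight_wadj k (T : finType) (G : wgraph T) n (v : 'I_n -> T)
    (f : {ffun 'I_k.+3 -> 'I_n}) : injective v -> injective f ->
  closed_walk_weight (wadj G v) f =
  if cyc_edges (v \o f) \subset gedges G
  then \prod_(e in cyc_edges (v \o f)) gwt G e else 0.
Proof.
move=> vi fi; have vfi := inj_comp vi fi.
case: ifPn => [/subsetP sub|/subsetPn[_ /imsetP[i _ ->] notE]].
  rewrite big_imset /=; last by move=> i j _ _; apply: (cyc_edge_inj vfi).
  by apply: eq_bigr => i _; rewrite mxE ifT //; apply/sub/imset_f.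
by rewrite /closed_walk_weight (bigD1 i) //= mxE (negbTE notE) mul0r.
Qed.

Lemma sum_injective_closed_walks k (T : finType) (G : wgraph T) n (v : 'I_n -> T) :
  labels G v ->
  \sum_(f : {ffun 'I_k.+3 -> 'I_n} | injectiveb f)
     closed_walk_weight (wadj G v) f = cycle_sum k.+3 G *+ (2 * k.+3).
Proof.
move=> [vi vG].
have cycE (f : {ffun 'I_k.+3 -> 'I_n}) :
    cyc_edges (v \o f) = [set v @: (e : {set 'I_n}) | e in cyc_edges f].
  rewrite /cyc_edges -imset_comp; apply: eq_imset => i.
  by rewrite /= imsetU !imset_set1.
transitivity (\sum_(f : {ffun 'I_k.+3 -> 'I_n} |
    injectiveb f && (cyc_edges (v \o f) \subset gedges G))
    \prod_(e in cyc_edges (v \o f)) gwt G e).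
  rewrite big_mkcondr; apply: eq_bigr => f /injectiveP fi.
  exact: closed_walk_weight_wadj.
rewrite (partition_big (fun f : {ffun 'I_k.+3 -> 'I_n} => cyc_edges (v \o f))
  (is_cycle k.+3 G)) /=; last first.
  move=> f /andP[/injectiveP fi sub]; apply/is_cycleP.
  exists [ffun i => v (f i)]; split=> //.
    by move=> i j; rewrite !ffunE => /vi/fi.
  by apply: eq_imset => i; rewrite !ffunE.
rewrite /cycle_sum -sumrMnl; apply: eq_bigr => C /is_cycleP[g [gi EC CG]].
(* Edges lie inside [gverts G], so the cycle lifts along [v] to a walk [f0] on labels. *)
have vg i : exists j, v j == g i.
  have [_ /subsetP sub] : #|[set g i; g (ordS i)]| = 2%N /\
      [set g i; g (ordS i)] \subset gverts G.
    by apply: gedgesP; apply: (subsetP CG); rewrite EC; apply: imset_f.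
  by have [j <-] := (vG (g i)).1 (sub _ (set21 _ _)); exists j.
pose f0 := [ffun i => xchoose (vg i)].
have f0E i : v (f0 i) = g i by rewrite ffunE; apply/eqP/(xchooseP (vg i)).
have f0i : injective f0 by move=> i j e; apply: gi; rewrite -!f0E e.
have EC0 : C = cyc_edges (v \o f0).
  by rewrite EC; apply: eq_imset => i; rewrite /= !f0E.
rewrite -(card_cyc_edges_fiber f0i) cardsE -sumr_const.
apply: eq_big => [f|f /andP[_ /eqP ->] //].
rewrite unfold_in /=.
(* As [v] is injective, comparing edge sets in [T] amounts to comparing them on labels, where the
   fiber has been counted. *)
have -> : (cyc_edges f == cyc_edges f0) = (cyc_edges (v \o f) == C).
  by rewrite EC0 !cycE; exact: esym (inj_eq (imset_inj (imset_inj vi)) _ _).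
rewrite -andbA; congr (_ && _); case: eqP => [->|]; by rewrite ?CG ?andbF.
Qed.

Lemma cycle_sum_trace_sum_pairs k (T : finType) (G : wgraph T) n (v : 'I_n -> T) :
  (3 <= k)%N -> labels G v ->
  toQwr (cycle_sum k G) = (2 * k)%N%:R^-1 *: toQwr (trace_sum_pairs k (wadj G v)).
Proof.
case: k => [|[|[|k]]] // _ Gv.
rewrite trace_sum_pairs_injective sum_injective_closed_walks // /toQwr raddfMn.
by rewrite /= -scaler_nat scalerA mulVf ?scale1r // Num.Theory.pnatr_eq0.
Qed.

(** * The link invariant *)

Lemma CWR_eq rule k L (D : diagram) :
  reduced_alternating_diagram L D -> CWR_well_defined rule k L ->
  CWR rule k L = CWR_diagram rule k D.
Proof.
move=> LD wd; rewrite /CWR; set P := fun p => _.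
(* [epsilon] picks the value on some diagram [D']; [wd] carries it over to [D]. *)
have [|D' LD' ->] := ClassicalEpsilon.epsilon_spec (inhabits (0, 0)) P.
  by exists (CWR_diagram rule k D), D.
exact: wd.
Qed.

Theorem theorem5p4 (k : nat) (hk : (3 <= k)%N) :
  (forall (T : finType) (G : wgraph T) (n : nat) (v : 'I_n -> T),
     labels G v ->
     let M := wadj G v in
     toQwr (cycle_sum k G) = (2 * k)%N%:R^-1 *: toQwr (trace_sum_pairs k M) /\
     (2 * k)%N%:R^-1 *: toQwr (trace_sum_pairs k M)
       = (2 * k)%N%:R^-1 *: toQwr (trace_sum k M))
  /\
  (forall (rule : bool) (L : oriented_link),
     non_split L -> alternating_link L ->
     forall D : diagram, reduced_alternating_diagram L D ->
     let GB := black_star rule D in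
     let GW := white_star rule D in
     (* CWR_k(L) does not depend on the reduced alternating diagram (known theorem) *)
     (CWR_well_defined rule k L ->
        CWR rule k L = (cycle_sum k GB, cycle_sum k GW)) /\
     (forall (n : nat) (v : 'I_n -> {set dart D}), labels GB v ->
        toQwr (cycle_sum k GB)
          = (2 * k)%N%:R^-1 *: toQwr (trace_sum k (wadj GB v))) /\
     (forall (n : nat) (v : 'I_n -> {set dart D}), labels GW v ->
        toQwr (cycle_sum k GW)
          = (2 * k)%N%:R^-1 *: toQwr (trace_sum k (wadj GW v)))).
Proof.
split=> [T G n v Gv M|rule L _ _ D LD GB GW].
  by split; [exact: cycle_sum_trace_sum_pairs|rewrite trace_sum_pairsE].
split; first exact: CWR_eq.
by split=> n v Gv; rewrite -trace_sum_pairsE; exact: cycle_sum_trace_sum_pairs.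
Qed.
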